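(* Let $I$ and $J$ be disjoint index sets, let $(\mathcal{A},\varphi)$ be a non-commutative probability space, let $((a_i)_{i\in I},(a_j)_{j\in J})$ be a two-faced family of random variables in $(\mathcal{A},\varphi)$, and let $\lambda>0$. For each natural number $N>\lambda$, let $(\mathcal{C}_N,\phi_N)$ be a $C^*$-probability space and let $p_N\in\mathcal{C}_N$ be a projection with $\phi_N(p_N)=\frac{\lambda}{N}$. Let $a_N=((a_i\otimes p_N)_{i\in I},(a_j\otimes p_N)_{j\in J})$, a two-faced family of random variables in $\mathcal{A}_N:=\mathcal{A}\otimes\mathcal{C}_N$ equipped with $\varphi_N:=\varphi\otimes\phi_N$. Let $\{((a_{N,i,m})_{i\in I},(a_{N,j,m})_{j\in J}) : m=1,2,\dots,N\}$ be a bi-free sequence of $N$ identically distributed two-faced families of random variables in $(\mathcal{A}_N,\varphi_N)$, each having the same distribution as $a_N$. Let $S_{N,k}=\sum_{m=1}^N a_{N,k,m}$ for $k\in I\sqcup J$, and $S_N=((S_{N,i})_{i\in I},(S_{N,j})_{j\in J})$. Then, as $N\to\infty$, $S_N$ converges in distribution to the compound bi-free Poisson distribution determined by $\lambda$ and the distribution of $((a_i)_{i\in I},(a_j)_{j\in J})$.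
   Context: A non-commutative probability space $(\mathcal{A},\varphi)$ is a unital complex algebra $\mathcal{A}$ with a linear functional $\varphi$ satisfying $\varphi(1)=1$; a $C^*$-probability space is one where $\mathcal{A}$ is a unital $C^*$-algebra and $\varphi$ is a state. A two-faced family in $(\mathcal{A},\varphi)$ is a family $((z_i)_{i\in I},(z_j)_{j\in J})$ of elements of $\mathcal{A}$, with left variables indexed by $I$ and right variables indexed by $J$. Its distribution is the unital linear functional $P\mapsto\varphi(P(z_k:k\in I\sqcup J))$ on the algebra $\mathbb{C}\langle X_k:k\in I\sqcup J\rangle$ of non-commutative polynomials. Convergence in distribution means pointwise convergence of these functionals on polynomials (convergence of all joint moments). Bi-non-crossing partitions and bi-free cumulants. For $\chi:\{1,\dots,n\}\to I\sqcup J$, call the position $k$ left if $\chi(k)\in I$ and right if $\chi(k)\in J$. If the left positions are $i_1<\dots<i_p$ and the right positions are $i_{p+1}>i_{p+2}>\dots>i_n$, let $s_\chi$ be the permutation $s_\chi(k)=i_k$, and let $BNC(\chi)=\{s_\chi\cdot\pi:\pi\in NC(n)\}$, where $NC(n)$ is the set of non-crossing partitions of $\{1,\dots,n\}$ and $s_\chi\cdot\pi=\{s_\chi(V):V\in\pi\}$. The same definitions apply to $\chi:\{1,\dots,n\}\to\{l,r\}$. The bi-free cumulants $\kappa_\chi:\mathcal{A}^n\to\mathbb{C}$ are the multilinear functionals (depending on $\chi$ only through its left/right pattern) determined recursively by $$\varphi(b_1\cdots b_n)=\sum_{\pi\in BNC(\chi)}\ \prod_{V\in\pi}\kappa_{\chi|_V}\big((b_1,\dots,b_n)|_V\big),\qquad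 b_1,\dots,b_n\in\mathcal{A},$$ where for $V=\{v_1<\dots<v_k\}$ one sets $(b_1,\dots,b_n)|_V=(b_{v_1},\dots,b_{v_k})$ and $\chi|_V$ is viewed as a map on $\{1,\dots,k\}$. Bi-freeness. A collection of two-faced families $((z_i^{(m)})_{i\in I},(z_j^{(m)})_{j\in J})$, $m\in M$, is bi-free if $\kappa_\chi(z^{(\epsilon_1)}_{\chi(1)},\dots,z^{(\epsilon_n)}_{\chi(n)})=0$ for all $n\ge2$, all $\chi:\{1,\dots,n\}\to I\sqcup J$ and all non-constant $\epsilon:\{1,\dots,n\}\to M$. Compound bi-free Poisson distribution. A two-faced family $((z_i)_{i\in I},(z_j)_{j\in J})$ has the compound bi-free Poisson distribution determined by $\lambda>0$ and the distribution of $a=((a_i)_{i\in I},(a_j)_{j\in J})$ in $(\mathcal{A},\varphi)$ if for every $n\in\mathbb{N}$ and $\chi:\{1,\dots,n\}\to I\sqcup J$, $\kappa_\chi(z_{\chi(1)},\dots,z_{\chi(n)})=\lambda\,\varphi(a_{\chi(1)}a_{\chi(2)}\cdots a_{\chi(n)})$. *)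

(* Defs.v *)
From HB Require Import structures.
(* The notations of monalg clash with those of the analysis library. *)
From mathcomp Require Import -(notations) monalg.
From mathcomp Require Import all_boot all_order all_fingroup all_algebra.
From mathcomp Require Import generic_quotient sesquilinear complex.
From mathcomp Require Import boolp classical_sets reals.
From mathcomp Require Import filter topology normedtype.
From mathcomp Require Import finset.

Set Implicit Arguments.
Unset Strict Implicit.
Unset Printing Implicit Defensive.

Import Order.TTheory GRing.Theory Num.Theory numFieldNormedType.Exports.
Local Open Scope ring_scope.
Local Open Scope complex_scope.

HB.mixin Record hasExpectation (R : realType) A of GRing.Algebra R[i] A := {
  expectation : {scalar A};
  expectation1 : expectation 1 = 1
}.

#[short(type="ncProbType")]
HB.structure Definition NCProb (R : realType) :=
  {A of GRing.Algebra R[i] A & hasExpectation R A}.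

HB.mixin Record isCStar (R : realType) A of GRing.Algebra R[i] A := {
  star : A -> A;
  starK : involutive star;
  starD : {morph star : x y / x + y};
  starZ : forall (k : R[i]) (x : A), star (k *: x) = (k^*)%R *: star x;
  starM : forall x y : A, star (x * y) = star y * star x;
  cnorm : A -> R;
  cnorm_eq0 : forall x, cnorm x = 0 -> x = 0;
  cnormD : forall x y, cnorm (x + y) <= cnorm x + cnorm y;
  cnormZ : forall (k : R[i]) (x : A), (cnorm (k *: x))%:C = `|k| * (cnorm x)%:C;
  cnormM : forall x y, cnorm (x * y) <= cnorm x * cnorm y;
  cnorm_starM : forall x, cnorm (star x * x) = cnorm x ^+ 2;
  cnorm_complete : forall u : nat -> A,
    (forall e : R, 0 < e -> exists N, forall m n,
       (N <= m)%N -> (N <= n)%N -> cnorm (u m - u n) < e) ->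
    exists l : A, forall e : R, 0 < e -> exists N, forall n,
       (N <= n)%N -> cnorm (u n - l) < e
}.

#[short(type="cstarType")]
HB.structure Definition CStar (R : realType) :=
  {A of GRing.Algebra R[i] A & isCStar R A}.

HB.mixin Record isState (R : realType) A of CStar R A & NCProb R A := {
  expectation_ge0 : forall x : A, 0 <= expectation (star x * x)
}.

#[short(type="cstarProbType")]
HB.structure Definition CStarProb (R : realType) :=
  {A of CStar R A & NCProb R A & isState R A}.

Definition is_projection (R : realType) (A : cstarType R) (p : A) :=
  star p = p /\ p * p = p.

(* A formal sum of elementary tensors is a sequence of pairs.  Two of them are
   identified when no bilinear map distinguishes them; the universal property
   is tensor_univ below. *)
Section TensorQuotient.
Context (K : fieldType) (U V : lmodType K).
Implicit Types (s t : seq (U * V)).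

Definition formal_eval (W : lmodType K) (f : U -> V -> W) s : W :=
  \sum_(x <- s) f x.1 x.2.

Definition formal_eq s t : bool :=
  `[< forall (W : lmodType K) (f : U -> V -> W),
        bilinear_for *:%R *:%R f -> formal_eval f s = formal_eval f t >].

Lemma formal_eqP s t :
  reflect (forall (W : lmodType K) (f : U -> V -> W),
             bilinear_for *:%R *:%R f -> formal_eval f s = formal_eval f t)
          (formal_eq s t).
Proof. exact: asboolP. Qed.

Lemma formal_eq_refl : reflexive formal_eq.
Proof. by move=> s; apply/formal_eqP. Qed.

Lemma formal_eq_sym : symmetric formal_eq.
Proof. by move=> s t; apply/formal_eqP/formal_eqP => h W f /h. Qed.

Lemma formal_eq_trans : transitive formal_eq.
Proof.
move=> t s r /formal_eqP st /formal_eqP tr.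
by apply/formal_eqP => W f bf; rewrite st // tr.
Qed.

Canonical formal_equiv :=
  EquivRel formal_eq formal_eq_refl formal_eq_sym formal_eq_trans.

Definition tensor : Type := {eq_quot formal_eq}%qT.
HB.instance Definition _ := Choice.on tensor.
HB.instance Definition _ := EqQuotient.on tensor.

Definition tens_of s : tensor := \pi_tensor%qT s.
Definition tens (u : U) (v : V) : tensor := tens_of [:: (u, v)].

Lemma tens_ofP s t :
  (forall (W : lmodType K) (f : U -> V -> W),
     bilinear_for *:%R *:%R f -> formal_eval f s = formal_eval f t) ->
  tens_of s = tens_of t.
Proof. by move=> h; apply/eqP; rewrite eqmodE; apply/formal_eqP. Qed.

Lemma formal_eval_repr (W : lmodType K) (f : U -> V -> W) s :
  bilinear_for *:%R *:%R f -> formal_eval f (repr (tens_of s)) = formal_eval f s.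
Proof.
move=> bf; suff /formal_eqP -> : formal_eq (repr (tens_of s)) s by [].
by rewrite -eqmodE reprK.
Qed.

Lemma tens_ofK (t : tensor) : tens_of (repr t) = t.
Proof. exact: reprK. Qed.

Lemma formal_eval_cat (W : lmodType K) (f : U -> V -> W) s t :
  formal_eval f (s ++ t) = formal_eval f s + formal_eval f t.
Proof. exact: big_cat. Qed.

Lemma formal_eval_scale (W : lmodType K) (f : U -> V -> W) k s :
  bilinear_for *:%R *:%R f ->
  formal_eval f [seq (k *: x.1, x.2) | x <- s] = k *: formal_eval f s.
Proof.
move=> bf; rewrite /formal_eval big_map scaler_sumr; apply: eq_bigr => x _.
exact: (scalable_linear (bf.1 x.2)).
Qed.

Definition tensor_add (x y : tensor) := tens_of (repr x ++ repr y).
Definition tensor_scale (k : K) (x : tensor) :=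
  tens_of [seq (k *: p.1, p.2) | p <- repr x].
Definition tensor_opp := tensor_scale (-1).

Lemma tensor_addE s t : tensor_add (tens_of s) (tens_of t) = tens_of (s ++ t).
Proof.
by apply: tens_ofP => W f bf; rewrite !formal_eval_cat !formal_eval_repr.
Qed.

Lemma tensor_scaleE k s :
  tensor_scale k (tens_of s) = tens_of [seq (k *: p.1, p.2) | p <- s].
Proof.
by apply: tens_ofP => W f bf; rewrite !formal_eval_scale // formal_eval_repr.
Qed.

Lemma tensor_addA : associative tensor_add.
Proof.
move=> x y z; rewrite -[x]tens_ofK -[y]tens_ofK -[z]tens_ofK.
by rewrite !tensor_addE catA.
Qed.

Lemma tensor_addC : commutative tensor_add.
Proof.
move=> x y; rewrite -[x]tens_ofK -[y]tens_ofK !tensor_addE.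
by apply: tens_ofP => W f bf; rewrite !formal_eval_cat addrC.
Qed.

Lemma tensor_add0 : left_id (tens_of [::]) tensor_add.
Proof. by move=> x; rewrite -[x]tens_ofK tensor_addE. Qed.

Lemma tensor_addN : left_inverse (tens_of [::]) tensor_opp tensor_add.
Proof.
move=> x; rewrite -[x]tens_ofK /tensor_opp tensor_scaleE tensor_addE.
apply: tens_ofP => W f bf.
by rewrite formal_eval_cat formal_eval_scale // scaleN1r addNr /formal_eval big_nil.
Qed.

HB.instance Definition _ := GRing.isZmodule.Build tensor
  tensor_addA tensor_addC tensor_add0 tensor_addN.

Lemma tens_ofD s t : tens_of (s ++ t) = tens_of s + tens_of t.
Proof. by rewrite -tensor_addE. Qed.

Lemma tensor_scaleA a b x :
  tensor_scale a (tensor_scale b x) = tensor_scale (a * b) x.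
Proof.
rewrite -[x]tens_ofK !tensor_scaleE -map_comp; congr tens_of.
by apply: eq_map => p /=; rewrite scalerA.
Qed.

Lemma tensor_scale1 : left_id 1 tensor_scale.
Proof.
move=> x; rewrite -[x]tens_ofK tensor_scaleE.
by apply: tens_ofP => W f bf; rewrite formal_eval_scale // scale1r.
Qed.

Lemma tensor_scaleDr : right_distributive tensor_scale +%R.
Proof.
move=> k x y; rewrite -[x]tens_ofK -[y]tens_ofK -tens_ofD !tensor_scaleE.
by rewrite -tens_ofD map_cat.
Qed.

Lemma tensor_scaleDl x : {morph tensor_scale^~ x : a b / a + b}.
Proof.
move=> a b; rewrite -[x]tens_ofK !tensor_scaleE -tens_ofD.
apply: tens_ofP => W f bf.
by rewrite formal_eval_cat !formal_eval_scale // scalerDl.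
Qed.

HB.instance Definition _ := GRing.Zmodule_isLmodule.Build K tensor
  tensor_scaleA tensor_scale1 tensor_scaleDr tensor_scaleDl.

Lemma tens_ofZ k s : tens_of [seq (k *: p.1, p.2) | p <- s] = k *: tens_of s.
Proof. by rewrite -tensor_scaleE. Qed.

Lemma tens_of_sum s : tens_of s = \sum_(x <- s) tens x.1 x.2.
Proof.
elim: s => [|[u v] s IHs]; first by rewrite big_nil.
by rewrite big_cons -IHs -tens_ofD.
Qed.

Lemma tens_bilinear : bilinear_for *:%R *:%R tens.
Proof.
split=> [v k u u' | u k v v'] /=; rewrite /tens -tens_ofZ -tens_ofD /=;
  apply: tens_ofP => W f bf; rewrite /formal_eval !big_cons !big_nil !addr0 /=.
  by have /= -> := scalable_linear (bf.1 v) k u; exact: (bf.1 v).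
by have /= -> := scalable_linear (bf.1 v) k u; exact: (bf.2 u).
Qed.

Definition tensor_lift (W : lmodType K) (f : U -> V -> W) (x : tensor) : W :=
  formal_eval f (repr x).

Lemma tensor_lift_linear (W : lmodType K) (f : U -> V -> W) :
  bilinear_for *:%R *:%R f -> linear (tensor_lift f).
Proof.
move=> bf k x y; rewrite -[x]tens_ofK -[y]tens_ofK -tens_ofZ -tens_ofD.
by rewrite /tensor_lift !formal_eval_repr // formal_eval_cat formal_eval_scale.
Qed.

Lemma tensor_lift_tens (W : lmodType K) (f : U -> V -> W) u v :
  bilinear_for *:%R *:%R f -> tensor_lift f (tens u v) = f u v.
Proof.
by move=> bf; rewrite /tensor_lift formal_eval_repr // /formal_eval big_seq1.
Qed.

Theorem tensor_univ (W : lmodType K) (f : U -> V -> W) :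
  bilinear_for *:%R *:%R f ->
  exists! g : tensor -> W, linear g /\ forall u v, g (tens u v) = f u v.
Proof.
move=> bf; exists (tensor_lift f); split.
  split; first exact: tensor_lift_linear.
  by move=> u v; exact: tensor_lift_tens.
move=> g [lg gE]; apply/funext => x; rewrite -[x]tens_ofK.
rewrite /tensor_lift formal_eval_repr // tens_of_sum.
pose gL := GRing.isLinear.Build _ _ _ _ g lg.
pose g' : {linear tensor -> W} := HB.pack g gL.
by rewrite -[g]/(g' : _ -> _) linear_sum; apply: eq_bigr => y _; rewrite -gE.
Qed.

End TensorQuotient.

Arguments tensor {K} U V.
Arguments tens {K U V} u v.

Notation "U ⊗ V" := (tensor U V) (at level 40, left associativity) : type_scope.
Notation "u ⊗ v" := (tens u v) (at level 40, left associativity) : ring_scope.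

Section TensorAlgebra.
Context (K : fieldType) (A B : algType K).
Implicit Types (s t : seq (A * B)).

Definition formal_mul s t : seq (A * B) :=
  [seq (x.1 * y.1, x.2 * y.2) | x <- s, y <- t].

Lemma formal_eval_mul (W : lmodType K) (f : A -> B -> W) s t :
  formal_eval f (formal_mul s t) =
  \sum_(x <- s) \sum_(y <- t) f (x.1 * y.1) (x.2 * y.2).
Proof. by rewrite /formal_eval big_allpairs_dep. Qed.

Lemma bilinear_mull (W : lmodType K) (f : A -> B -> W) t :
  bilinear_for *:%R *:%R f ->
  bilinear_for *:%R *:%R
    (fun a b => \sum_(y <- t) f (a * y.1) (b * y.2)).
Proof.
move=> bf; split=> [b k a a' | a k b b'] /=;
  rewrite scaler_sumr -big_split /=; apply: eq_bigr => y _.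
  by rewrite mulrDl -scalerAl; exact: (bf.1 (b * y.2)).
by rewrite mulrDl -scalerAl; exact: (bf.2 (a * y.1)).
Qed.

Lemma bilinear_mulr (W : lmodType K) (f : A -> B -> W) s :
  bilinear_for *:%R *:%R f ->
  bilinear_for *:%R *:%R
    (fun a b => \sum_(x <- s) f (x.1 * a) (x.2 * b)).
Proof.
move=> bf; split=> [b k a a' | a k b b'] /=;
  rewrite scaler_sumr -big_split /=; apply: eq_bigr => x _.
  by rewrite mulrDr -scalerAr; exact: (bf.1 (x.2 * b)).
by rewrite mulrDr -scalerAr; exact: (bf.2 (x.1 * a)).
Qed.

Definition tensor_mul (x y : A ⊗ B) : A ⊗ B :=
  tens_of (formal_mul (repr x) (repr y)).

Lemma tensor_mulE s t :
  tensor_mul (tens_of s) (tens_of t) = tens_of (formal_mul s t).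
Proof.
apply: tens_ofP => W f bf; rewrite !formal_eval_mul.
apply: etrans (formal_eval_repr s (bilinear_mull (repr (tens_of t)) bf)) _.
rewrite /formal_eval exchange_big [RHS]exchange_big /=.
exact: (formal_eval_repr t (bilinear_mulr s bf)).
Qed.

Lemma tensor_mulA : associative tensor_mul.
Proof.
move=> x y z; rewrite -[x]tens_ofK -[y]tens_ofK -[z]tens_ofK !tensor_mulE.
apply: tens_ofP => W f bf; rewrite !formal_eval_mul.
under eq_bigr do rewrite big_allpairs_dep.
rewrite big_allpairs_dep; apply: eq_bigr => a _.
apply: eq_bigr => b _; apply: eq_bigr => c _ /=.
by rewrite !mulrA.
Qed.

Lemma tensor_mul1l : left_id (1 ⊗ 1) tensor_mul.
Proof.
move=> x; rewrite -[x]tens_ofK tensor_mulE; apply: tens_ofP => W f bf.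
rewrite formal_eval_mul big_seq1; apply: eq_bigr => y _ /=.
by rewrite !mul1r.
Qed.

Lemma tensor_mul1r : right_id (1 ⊗ 1) tensor_mul.
Proof.
move=> x; rewrite -[x]tens_ofK tensor_mulE; apply: tens_ofP => W f bf.
rewrite formal_eval_mul; apply: eq_bigr => y _ /=.
by rewrite big_seq1 /= !mulr1.
Qed.

Lemma tensor_mulDl : left_distributive tensor_mul +%R.
Proof.
move=> x y z; rewrite -[x]tens_ofK -[y]tens_ofK -[z]tens_ofK -tens_ofD.
rewrite !tensor_mulE -tens_ofD; apply: tens_ofP => W f bf.
by rewrite formal_eval_cat !formal_eval_mul big_cat.
Qed.

Lemma tensor_mulDr : right_distributive tensor_mul +%R.
Proof.
move=> x y z; rewrite -[x]tens_ofK -[y]tens_ofK -[z]tens_ofK -tens_ofD.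
rewrite !tensor_mulE -tens_ofD; apply: tens_ofP => W f bf.
rewrite formal_eval_cat !formal_eval_mul -big_split.
by apply: eq_bigr => a _; rewrite big_cat.
Qed.

HB.instance Definition _ := GRing.Zmodule_isPzRing.Build (A ⊗ B)%type
  tensor_mulA tensor_mul1l tensor_mul1r tensor_mulDl tensor_mulDr.

Lemma tens_ofM s t : tens_of s * tens_of t = tens_of (formal_mul s t).
Proof. exact: tensor_mulE. Qed.

Lemma tensM (a a' : A) (b b' : B) :
  (a ⊗ b) * (a' ⊗ b') = (a * a') ⊗ (b * b') :> A ⊗ B.
Proof. exact: tens_ofM. Qed.

Lemma tensor_scalerAl (k : K) (x y : A ⊗ B) : k *: (x * y) = (k *: x) * y.
Proof.
rewrite -[x]tens_ofK -[y]tens_ofK tens_ofM -!tens_ofZ tens_ofM.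
apply: tens_ofP => W f bf.
rewrite formal_eval_scale // !formal_eval_mul big_map scaler_sumr.
apply: eq_bigr => a _; rewrite scaler_sumr; apply: eq_bigr => b _ /=.
by rewrite -scalerAl -(scalable_linear (bf.1 _)).
Qed.

Lemma tensor_scalerAr (k : K) (x y : A ⊗ B) : k *: (x * y) = x * (k *: y).
Proof.
rewrite -[x]tens_ofK -[y]tens_ofK tens_ofM -!tens_ofZ tens_ofM.
apply: tens_ofP => W f bf.
rewrite formal_eval_scale // !formal_eval_mul scaler_sumr.
apply: eq_bigr => a _; rewrite big_map scaler_sumr; apply: eq_bigr => b _ /=.
by rewrite -scalerAr -(scalable_linear (bf.1 _)).
Qed.

End TensorAlgebra.

Section TensorNCProb.
Context (R : realType) (A B : ncProbType R).

Definition expectation_mul (a : A) (b : B) : (R[i])^o :=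
  expectation a * expectation b.

Lemma expectation_mul_bilinear : bilinear_for *:%R *:%R expectation_mul.
Proof.
split=> [b k a a' | a k b b'] /=; rewrite /expectation_mul linearP /=.
  by rewrite mulrDl -mulrA.
by rewrite mulrDr mulrCA.
Qed.

Definition tensor_expectation (x : A ⊗ B) : R[i] :=
  tensor_lift expectation_mul x.

Lemma tensor_expectation_tens (a : A) (b : B) :
  tensor_expectation (a ⊗ b) = expectation a * expectation b.
Proof. exact: (tensor_lift_tens a b expectation_mul_bilinear). Qed.

Lemma tensor_expectation_linear : scalar tensor_expectation.
Proof. exact: (tensor_lift_linear expectation_mul_bilinear). Qed.

HB.instance Definition _ :=
  GRing.isLinear.Build R[i] (A ⊗ B)%type R[i] *%R tensor_expectation
    tensor_expectation_linear.

Lemma tensor_oner_neq0 : (1 : A ⊗ B) != 0.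
Proof.
apply/eqP => /(congr1 tensor_expectation) /eqP.
rewrite linear0 tensor_expectation_tens !expectation1 mulr1.
by rewrite oner_eq0.
Qed.

HB.instance Definition _ :=
  GRing.PzSemiRing_isNonZero.Build (A ⊗ B)%type tensor_oner_neq0.
HB.instance Definition _ :=
  GRing.Lmodule_isLalgebra.Build R[i] (A ⊗ B)%type (@tensor_scalerAl _ A B).
HB.instance Definition _ :=
  GRing.Lalgebra_isAlgebra.Build R[i] (A ⊗ B)%type (@tensor_scalerAr _ A B).

Lemma tensor_expectation1 : tensor_expectation 1 = 1.
Proof. by rewrite tensor_expectation_tens !expectation1 mulr1. Qed.

HB.instance Definition _ :=
  hasExpectation.Build R (A ⊗ B)%type tensor_expectation1.

Lemma expectation_tens (a : A) (b : B) :
  expectation (a ⊗ b : A ⊗ B) = expectation a * expectation b.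
Proof. exact: tensor_expectation_tens. Qed.

End TensorNCProb.

(* Positions are 0, ..., n - 1, and a left/right pattern is a map to bool that
   is true at the left positions. *)

Definition noncrossing n (P : {set {set 'I_n}}) : bool :=
  [forall V in P, forall W in P, (V != W) ==>
    ~~ [exists a in V, exists b in W, exists c in V, exists d in W,
          [&& (a < b)%N, (b < c)%N & (c < d)%N]]].

Definition NC n : {set {set {set 'I_n}}} :=
  [set P | partition P [set: 'I_n] && noncrossing P].

Section BiNonCrossing.
Context (n : nat) (chi : 'I_n -> bool).

(* The left positions in increasing order, then the right positions in
   decreasing order. *)
Definition chi_seq : seq 'I_n :=
  [seq k <- enum 'I_n | chi k] ++ rev [seq k <- enum 'I_n | ~~ chi k].

Lemma perm_chi_seq : perm_eq chi_seq (enum 'I_n).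
Proof.
by rewrite /chi_seq perm_sym -(perm_filterC chi) perm_cat2l perm_sym perm_rev.
Qed.

Lemma size_chi_seq : size chi_seq = n.
Proof. by rewrite (perm_size perm_chi_seq) size_enum_ord. Qed.

Lemma chi_fun_inj : injective (fun k : 'I_n => nth k chi_seq k).
Proof.
move=> j k /= eq_jk; apply: val_inj; apply/eqP.
have uniq_s : uniq chi_seq by rewrite (perm_uniq perm_chi_seq) enum_uniq.
rewrite -(@nth_uniq _ j chi_seq) ?size_chi_seq ?ltn_ord //.
by rewrite eq_jk (set_nth_default j) // size_chi_seq.
Qed.

Definition chi_perm : 'S_n := perm chi_fun_inj.

Definition BNC : {set {set {set 'I_n}}} :=
  [set [set chi_perm @: V | V : {set 'I_n} in P] | P : {set {set 'I_n}} in NC n].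

End BiNonCrossing.

Lemma imset_permT n (s : 'S_n) : s @: [set: 'I_n] = [set: 'I_n].
Proof.
apply/setP => x; rewrite in_setT; apply/imsetP.
by exists ((s^-1)%g x); rewrite ?in_setT ?permKV.
Qed.

Lemma BNC_block n (chi : 'I_n -> bool) pi (V : {set 'I_n}) :
  pi \in BNC chi -> V \in pi -> pi != [set [set: 'I_n]] -> (0 < #|V| < n)%N.
Proof.
case/imsetP => P; rewrite inE => /andP[partP _] ->.
case/imsetP => U UP -> piT; rewrite card_imset; last exact: perm_inj.
have /and3P[/eqP coverP /trivIsetP trivP P0] := partP.
apply/andP; split.
  by rewrite card_gt0; apply: contraNneq P0 => <-.
have leUn : (#|U| <= n)%N by rewrite -[X in (_ <= X)%N]card_ord max_card.
rewrite ltn_neqAle leUn andbT.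
apply: contraNneq piT => cardU.
have UT : U = [set: 'I_n].
  by apply/eqP; rewrite eqEcard subsetT cardsT card_ord cardU leqnn.
suff -> : P = [set U].
  by rewrite imset_set1 UT imset_permT.
apply/setP => W; rewrite in_set1; apply/idP/eqP => [WP|-> //].
apply/eqP; apply: contraNT P0 => WU.
have := trivP _ _ WP UP WU; rewrite UT -setI_eq0 setIT => /eqP <-.
exact: WP.
Qed.

Lemma setT_BNC n (chi : 'I_n -> bool) :
  (0 < n)%N -> [set [set: 'I_n]] \in BNC chi.
Proof.
move=> n0; apply/imsetP; exists [set [set: 'I_n]].
  rewrite inE; apply/andP; split.
    apply/and3P; split; first by rewrite cover1.
      by apply/trivIsetP => A B /set1P -> /set1P ->; rewrite eqxx.
    rewrite in_set1 eq_sym -card_gt0 cardsT card_ord //.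
  apply/'forall_implyP => V /set1P ->; apply/'forall_implyP => W /set1P ->.
  by rewrite eqxx.
by rewrite imset_set1 imset_permT.
Qed.

Section Cumulants.
Context (R : realType) (A : ncProbType R).

(* enum_val : 'I_#|V| -> 'I_n is the increasing enumeration of the block V. *)
Fixpoint bifree_cumulant_rec (m n : nat) (chi : 'I_n -> bool) (b : 'I_n -> A) : R[i] :=
  if m is m'.+1 then
    expectation (\prod_(k < n) b k) -
    \sum_(pi in BNC chi | pi != [set [set: 'I_n]]) \prod_(V in pi)
      bifree_cumulant_rec m' (fun j : 'I_#|V| => chi (enum_val j))
                      (fun j : 'I_#|V| => b (enum_val j))
  else 0.

Definition bifree_cumulant n (chi : 'I_n -> bool) (b : 'I_n -> A) : R[i] :=
  bifree_cumulant_rec n chi b.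

Lemma bifree_cumulant_cast m n (e : m = n) (chi : 'I_n -> bool) (b : 'I_n -> A) :
  bifree_cumulant (fun j => chi (cast_ord e j)) (fun j => b (cast_ord e j)) =
  bifree_cumulant chi b.
Proof.
by case: n / e chi b => chi b; congr (bifree_cumulant _ _);
  apply/funext => j; rewrite cast_ord_id.
Qed.

Lemma bifree_cumulant_rec_fuel m1 m2 n (chi : 'I_n -> bool) (b : 'I_n -> A) :
  (0 < n)%N -> (n <= m1)%N -> (n <= m2)%N ->
  bifree_cumulant_rec m1 chi b = bifree_cumulant_rec m2 chi b.
Proof.
elim: m1 m2 n chi b => [|m1 IH] [|m2] [|n] //= chi b _ nm1 nm2.
congr (_ - _); apply: eq_bigr => pi /andP[piB piT].
apply: eq_bigr => V Vpi; have /andP[V0 Vn] := BNC_block piB Vpi piT.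
by apply: IH => //; rewrite -ltnS; apply: leq_trans Vn _.
Qed.

Theorem moment_cumulant n (chi : 'I_n -> bool) (b : 'I_n -> A) : (0 < n)%N ->
  expectation (\prod_(k < n) b k) =
  \sum_(pi in BNC chi) \prod_(V in pi)
    bifree_cumulant (fun j : 'I_#|V| => chi (enum_val j))
             (fun j : 'I_#|V| => b (enum_val j)).
Proof.
case: n chi b => // n chi b _.
rewrite (bigD1 [set [set: 'I_n.+1]]) ?setT_BNC //= big_set1.
have -> : \sum_(pi in BNC chi | pi != [set [set: 'I_n.+1]]) \prod_(V in pi)
    bifree_cumulant (fun j : 'I_#|V| => chi (enum_val j))
             (fun j : 'I_#|V| => b (enum_val j)) =
  \sum_(pi in BNC chi | pi != [set [set: 'I_n.+1]]) \prod_(V in pi)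
    bifree_cumulant_rec n (fun j : 'I_#|V| => chi (enum_val j))
             (fun j : 'I_#|V| => b (enum_val j)).
  apply: eq_bigr => pi /andP[piB piT]; apply: eq_bigr => V Vpi.
  have /andP[V0 Vn] := BNC_block piB Vpi piT.
  by apply: bifree_cumulant_rec_fuel.
suff -> : bifree_cumulant (fun j : 'I_#|[set: 'I_n.+1]| => chi (enum_val j))
    (fun j : 'I_#|[set: 'I_n.+1]| => b (enum_val j)) = bifree_cumulant chi b.
  by rewrite /bifree_cumulant /= subrK.
have cT : #|[set: 'I_n.+1]| = n.+1 by rewrite cardsT card_ord.
have evE (j : 'I_#|[set: 'I_n.+1]|) : enum_val j = cast_ord cT j.
  apply: val_inj => /=; rewrite /enum_val enum_setT -enumT.
  by rewrite nth_enum_ord // -[X in (_ < X)%N]cT.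
rewrite -(bifree_cumulant_cast cT).
by congr (bifree_cumulant _ _); apply/funext => j; rewrite evE.
Qed.

End Cumulants.

(* A two-faced family in A with disjoint index sets I and J is a map from the
   sum type I + J to A. *)

Definition ncpoly (R : realType) (X : choiceType) : Type :=
  malg (fmonom X) R[i].

Definition nceval (R : realType) (X : choiceType) (A : ncProbType R)
    (z : X -> A) (P : ncpoly R X) : A :=
  mmap (in_alg A) (fun w : fmonom X => \prod_(x <- (w : seq X)) z x) P.

Definition distribution (R : realType) (X : choiceType) (A : ncProbType R)
    (z : X -> A) (P : ncpoly R X) : R[i] :=
  expectation (nceval z P).

(* R[i]^o is R[i] with the topology given by the modulus. *)
Definition cvg_in_distribution (R : realType) (X : choiceType)
    (mu_ : nat -> ncpoly R X -> R[i]) (mu : ncpoly R X -> R[i]) : Prop :=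
  forall P, ((fun N => mu_ N P : R[i]^o) @ \oo --> (mu P : R[i]^o))%classic.

Definition bifree (R : realType) (I J M : Type) (A : ncProbType R)
    (z : M -> I + J -> A) : Prop :=
  forall n (chi : 'I_n -> I + J) (eps : 'I_n -> M), (2 <= n)%N ->
    (exists j k, eps j <> eps k) ->
    bifree_cumulant (fun k => is_inl (chi k)) (fun k => z (eps k) (chi k)) = 0.

Definition compound_bifree_poisson (R : realType) (I J : Type)
    (A B : ncProbType R) (lambda : R) (a : I + J -> A) (z : I + J -> B) : Prop :=
  forall n (chi : 'I_n -> I + J), (0 < n)%N ->
    bifree_cumulant (fun k => is_inl (chi k)) (fun k => z (chi k)) =
    lambda%:C * expectation (\prod_(k < n) a (chi k)).

Definition compound_bifree_poisson_distribution (R : realType)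
    (I J : choiceType) (A : ncProbType R) (lambda : R) (a : I + J -> A)
    (mu : ncpoly R (I + J)%type -> R[i]) : Prop :=
  exists (B : ncProbType R) (z : I + J -> B),
    compound_bifree_poisson lambda a z /\ mu = distribution z.

(* Main.v *)
From HB Require Import structures.
From mathcomp Require Import -(notations) finmap monalg.
Require Import Defs.
From mathcomp Require Import all_boot all_order all_fingroup all_algebra complex.
From mathcomp Require Import boolp classical_sets reals filter topology.
From mathcomp Require Import normedtype sequences.
From mathcomp Require Import fintype finset.

(** This is a limit theorem of Poisson type, and it is read off from cumulants.

    Why it holds.  Moments are sums over bi-non-crossing partitions of products
    of cumulants, so convergence of all cumulants of S_N gives convergence of
    all its moments ([cvg_family_moment]).  Cumulants of sums of bi-free
    families add up ([family_cumulant_sum]), and the summands are identically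
    distributed, so a cumulant of S_N is N times the cumulant of the family
    a_k ⊗ p_N.  The moments of that family are small: p_N is idempotent of
    expectation lambda / N, so N times the moment of any nonempty word w is
    exactly lambda times the moment of w in a
    ([tens_projection_moment]).  Passing from moments to cumulants subtracts
    products over partitions with at least two blocks; each block contributes a
    factor of order 1 / N, so after multiplication by N these products still
    vanish in the limit, and N times the cumulant has the same limit as N times
    the moment ([cvg_natr_mul_cumulant]).  That limit is the cumulant of the
    compound bi-free Poisson distribution.

    Such a distribution exists because cumulants can be prescribed: on the free
    algebra over the index set, the moment-cumulant formula itself defines a
    unital linear functional, and the moments of all words determine the
    cumulants ([cumulant_unique], [free_gen_cumulant]). *)

Set Implicit Arguments.
Unset Strict Implicit.
Unset Printing Implicit Defensive.

Import Order.TTheory GRing.Theory Num.Theory numFieldNormedType.Exports.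
Local Open Scope ring_scope.
Local Open Scope complex_scope.

(** * Words indexed by ordinals and their restrictions to blocks *)

(** Lengths such as #|[set: 'I_n]| and size [tuple w k | k < n] equal n only
    up to a proof, so a functional of words cannot be rewritten across them;
    this transports it along the equality of lengths. *)
Lemma indexed_word_eq (X T : Type) (f : forall n, ('I_n -> X) -> T) m n
    (e : m = n) (w : 'I_m -> X) (w' : 'I_n -> X) :
  (forall j, w j = w' (cast_ord e j)) -> f m w = f n w'.
Proof.
case: n / e w' => w' ww'; congr (f m _).
by apply/funext => j; rewrite ww' cast_ord_id.
Qed.

Definition subword (X : Type) n (w : 'I_n -> X) (V : {set 'I_n}) (j : 'I_#|V|) :=
  w (enum_val j).

Arguments subword {X n} w V j.

Lemma subwordT (X T : Type) (f : forall n, ('I_n -> X) -> T) n (w : 'I_n -> X) :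
  f _ (subword w [set: 'I_n]) = f n w.
Proof.
have cT : #|[set: 'I_n]| = n by rewrite cardsT card_ord.
apply: (@indexed_word_eq _ _ f _ _ cT) => j; congr w; apply: val_inj => /=.
by rewrite /enum_val enum_setT -enumT nth_enum_ord // -[X in (_ < X)%N]cT.
Qed.

Lemma BNC_partition n (chi : 'I_n -> bool) pi :
  pi \in BNC chi -> partition pi [set: 'I_n].
Proof.
case/imsetP => P; rewrite inE => /andP[partP _] ->.
rewrite -[X in partition _ X](imset_permT (chi_perm chi)).
by rewrite imset_partition //; exact: perm_inj.
Qed.

(** * Moments and cumulants of a two-faced family *)

Section MomentCumulant.
Context (R : realType) (I J : Type).
Local Notation X := (I + J)%type.
Implicit Types (c : forall n, ('I_n -> X) -> R[i]).

Definition left_pattern n (w : 'I_n -> X) : 'I_n -> bool := fun k => is_inl (w k).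

Definition moment_of_cumulants c n (w : 'I_n -> X) : R[i] :=
  \sum_(pi in BNC (left_pattern w)) \prod_(V in pi) c _ (subword w V).

(** The nonlinear part of the moment-cumulant formula: all blocks are proper, so
    only values of c on words of length below n occur. *)
Definition lower_terms c n (w : 'I_n -> X) : R[i] :=
  \sum_(pi in BNC (left_pattern w) | pi != [set [set: 'I_n]])
     \prod_(V in pi) c _ (subword w V).

Lemma moment_of_cumulantsE c n (w : 'I_n -> X) : (0 < n)%N ->
  moment_of_cumulants c w = c n w + lower_terms c w.
Proof.
move=> n0; rewrite /moment_of_cumulants (bigD1 [set [set: 'I_n]]) ?setT_BNC //=.
by rewrite big_set1 (subwordT c).
Qed.

Definition family_moment (A : ncProbType R) (z : X -> A) n (w : 'I_n -> X) :=
  expectation (\prod_(k < n) z (w k)).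

Definition family_cumulant (A : ncProbType R) (z : X -> A) n (w : 'I_n -> X) :=
  bifree_cumulant (left_pattern w) (fun k => z (w k)).

Lemma family_momentE (A : ncProbType R) (z : X -> A) n (w : 'I_n -> X) :
  (0 < n)%N ->
  family_moment z w = moment_of_cumulants (family_cumulant z) w.
Proof. exact: (moment_cumulant (left_pattern w)). Qed.

Lemma family_cumulantE (A : ncProbType R) (z : X -> A) n (w : 'I_n -> X) :
  (0 < n)%N ->
  family_cumulant z w =
  family_moment z w - lower_terms (family_cumulant z) w.
Proof. by move=> n0; rewrite family_momentE // moment_of_cumulantsE // addrK. Qed.

(** The moment-cumulant formula is triangular: its one-block term is the
    cumulant of the whole word, and the other terms only involve shorter words.
    Hence, by induction on the length, it has a single solution. *)
Lemma cumulant_unique (A : ncProbType R) (z : X -> A) c :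
  (forall n (w : 'I_n -> X), (0 < n)%N ->
     family_moment z w = moment_of_cumulants c w) ->
  forall n (w : 'I_n -> X), (0 < n)%N -> family_cumulant z w = c n w.
Proof.
move=> zc n; elim/ltn_ind: n => n IH w n0.
rewrite family_cumulantE // zc // moment_of_cumulantsE //.
apply/eqP; rewrite subr_eq; apply/eqP; congr (_ + _).
apply: eq_bigr => pi /andP[piB piT]; apply: eq_bigr => V Vpi.
by have /andP[V0 Vn] := BNC_block piB Vpi piT; rewrite IH.
Qed.

Lemma eq_family_cumulant (A B : ncProbType R) (z : X -> A) (y : X -> B) :
  (forall n (w : 'I_n -> X), family_moment z w = family_moment y w) ->
  forall n (w : 'I_n -> X), (0 < n)%N ->
    family_cumulant z w = family_cumulant y w.
Proof.
by move=> zy; apply: cumulant_unique => n w n0; rewrite zy family_momentE.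
Qed.

(** By uniqueness it is enough that the sums of cumulants satisfy the
    moment-cumulant formula.  Expanding the moment of the sum over all labellings
    eps of the positions and applying the formula to each term, bi-freeness kills
    every labelling that is not constant on each block of pi.  A labelling
    constant on blocks is a function from pi to M, and the sum over those
    functions of the products over blocks is the product over blocks of the sums
    over M. *)
Lemma family_cumulant_sum (A : ncProbType R) (M : finType) (z : M -> X -> A) :
  bifree z -> forall n (w : 'I_n -> X), (0 < n)%N ->
  family_cumulant (fun x => \sum_m z m x) w = \sum_m family_cumulant (z m) w.
Proof.
move=> zfree.
apply: (@cumulant_unique _ _ (fun n w => \sum_m family_cumulant (z m) w)).
case=> // n w _.
rewrite /family_moment bigA_distr_bigA linear_sum /=.
under eq_bigr => eps _ do rewrite (moment_cumulant (left_pattern w)) //.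
rewrite exchange_big /=; apply: eq_bigr => pi /BNC_partition pipart.
(* With no summand both sides vanish, pi being nonempty. *)
have [m0 _ | M0] := pickP (@predT M); last first.
  have eps0 (eps : {ffun 'I_n.+1 -> M}) : False by have := M0 (eps ord0).
  rewrite big1; last by move=> eps; case: (eps0 eps).
  have Tpi : pblock pi ord0 \in pi.
    by rewrite pblock_mem // (cover_partition pipart).
  by rewrite (bigD1 _ Tpi) /= [X in _ = X * _]big1 ?mul0r // => m; have := M0 m.
rewrite (big_distr_big m0) /=.
pose rep := transversal_repr ord0 (transversal pi [set: 'I_n.+1]).
have repP V : V \in pi -> rep V \in V.
  exact: repr_mem_pblock (transversalP pipart) ord0 V.
have piP k : pblock pi k \in pi.
  by rewrite pblock_mem // (cover_partition pipart).
have kpi k : k \in pblock pi k by rewrite mem_pblock (cover_partition pipart).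
have triv := partition_trivIset pipart.
(* Functions on blocks and labellings constant on blocks correspond through
   spreading a value over its block and sampling it at a representative; m0 is
   the default value off pi. *)
pose spread (h : {ffun {set 'I_n.+1} -> M}) := [ffun k => h (pblock pi k)].
pose sample (eps : {ffun 'I_n.+1 -> M}) :=
  [ffun V => if V \in pi then eps (rep V) else m0].
have spreadK h : h \in pffun_on m0 (mem pi) predT -> sample (spread h) = h.
  case/pffun_onP => /subsetP hpi _; apply/ffunP => V; rewrite !ffunE.
  case: ifPn => [Vpi|Vpi]; first by rewrite (def_pblock triv Vpi) ?repP.
  by apply/esym/eqP; apply: contraNT Vpi => hV; exact: hpi.
rewrite [RHS](reindex_onto sample spread) //=.
have sampleE eps : sample eps \in pffun_on m0 (mem pi) predT.
  apply/pffun_onP; split=> //; apply/subsetP => V.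
  by rewrite !inE ffunE; case: ifP => //; rewrite eqxx.
rewrite (bigID (fun eps => spread (sample eps) == eps)) /=.
rewrite [X in _ + X]big1 ?addr0; last first.
  (* Here eps takes two values on the block of some k. *)
  move=> eps /eqP neq_eps.
  have [k epsk] : exists k, eps (rep (pblock pi k)) <> eps k.
    apply: contrapT => noK; apply: neq_eps; apply/ffunP => k; rewrite !ffunE piP.
    by apply: contrapT => ?; apply: noK; exists k.
  rewrite (bigD1 _ (piP k)) /=; set V := pblock pi k in epsk *.
  have Vk : k \in V := kpi k; have Vr : rep V \in V := repP _ (piP k).
  rewrite (zfree _ (subword w V) (subword eps V)) ?mul0r //.
    rewrite ltnNge; apply/negP => /card_le1_eqP V1.
    by apply: epsk; rewrite (V1 _ _ Vk Vr).
  exists (enum_rank_in Vk (rep V)), (enum_rank_in Vk k).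
  by rewrite /subword !enum_rankK_in.
apply: eq_big => [eps|eps /eqP epsE]; first by rewrite sampleE.
apply: eq_bigr => V Vpi; rewrite /family_cumulant ffunE Vpi.
congr (bifree_cumulant _ _); apply/funext => j; congr (z _ _).
have Vj := enum_valP j.
by rewrite -{1}epsE !ffunE (def_pblock triv Vpi Vj) Vpi.
Qed.

End MomentCumulant.

(** * Limits of moments and cumulants *)

Section Limits.
Local Open Scope classical_set_scope.
Local Open Scope ring_scope.
Context (R : realType).

(** The modulus of 1 / N in R[i] is its modulus in R. *)
Lemma cvg_inv_natr : (fun N => N%:R^-1 : R[i]^o) @ \oo --> (0 : R[i]^o).
Proof.
apply/cvgr0Pnorm_lt => e e0.
have eE : e = (complex.Re e)%:C.
  by apply/eqP; rewrite eq_complex /= eqxx; move: e0; rewrite ltcE => /andP[].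
have re0 : 0 < complex.Re e by rewrite -ltcR -eE.
have := @cvg_harmonic R; move/cvgr0Pnorm_lt => /(_ _ re0) [N _ HN].
exists N.+1 => // -[//|n] /= Nn; have := HN n Nn; rewrite /harmonic /=.
rewrite eE -ltcR; congr (_ < _).
rewrite -[n.+1%:R in RHS](rmorph_nat (real_complex R)) -fmorphV normc_def /=.
by rewrite expr0n addr0 sqrtr_sqr.
Qed.

Lemma cvg_bigop_mul (I : Type) (r : seq I) (P : pred I)
    (u : I -> nat -> R[i]^o) (l : I -> R[i]^o) :
  (forall i, P i -> u i @ \oo --> l i) ->
  (fun N => \prod_(i <- r | P i) u i N) @ \oo --> \prod_(i <- r | P i) l i.
Proof. by move=> ul; apply: cvg_big => //; exact: mul_continuous. Qed.

Lemma cvg_bigop_add (I : Type) (r : seq I) (P : pred I)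
    (u : I -> nat -> R[i]^o) (l : I -> R[i]^o) :
  (forall i, P i -> u i @ \oo --> l i) ->
  (fun N => \sum_(i <- r | P i) u i N) @ \oo --> \sum_(i <- r | P i) l i.
Proof. by move=> ul; apply: cvg_big => //; exact: add_continuous. Qed.

Lemma cvg_sum0 (I : Type) (r : seq I) (P : pred I) (u : I -> nat -> R[i]^o) :
  (forall i, P i -> u i @ \oo --> (0 : R[i]^o)) ->
  (fun N => \sum_(i <- r | P i) u i N) @ \oo --> (0 : R[i]^o).
Proof. by move=> /cvg_bigop_add -/(_ r); rewrite big1. Qed.

Lemma cvg_eventually_eq (u v : nat -> R[i]^o) (l : R[i]^o) (N0 : nat) :
  (forall N, (N0 <= N)%N -> u N = v N) -> u @ \oo --> l -> v @ \oo --> l.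
Proof.
by move=> uv; apply: cvg_trans; apply: near_eq_cvg; exists N0.
Qed.

Context (I J : Type).
Local Notation X := (I + J)%type.

Lemma cvg_moment_of_cumulants (c_ : nat -> forall n, ('I_n -> X) -> R[i]^o)
    (c : forall n, ('I_n -> X) -> R[i]^o) :
  (forall n (w : 'I_n -> X), (0 < n)%N ->
     (fun N => c_ N n w : R[i]^o) @ \oo --> c n w) ->
  forall n (w : 'I_n -> X),
  (fun N => moment_of_cumulants (c_ N) w : R[i]^o) @ \oo -->
    (moment_of_cumulants c w : R[i]^o).
Proof.
move=> cvg_c n w; apply: cvg_bigop_add => pi piB.
apply: cvg_bigop_mul => V Vpi; apply: cvg_c.
by rewrite card_gt0 (partition_neq0 (BNC_partition piB)).
Qed.

(** Moments of order 1 / N force cumulants of order 1 / N, with the same leading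
    coefficient.  In the formula for the cumulant, the correction is a sum of
    products over partitions with at least two blocks.  Multiplying such a
    product by N turns the factor of one block into a convergent sequence, by
    induction, while the factor of a second block tends to 0. *)
Lemma cvg_natr_mul_cumulant (A_ : nat -> ncProbType R)
    (z_ : forall N, X -> A_ N) (m : forall n, ('I_n -> X) -> R[i]^o) :
  (forall n (w : 'I_n -> X), (0 < n)%N ->
     (fun N => N%:R * family_moment (z_ N) w : R[i]^o) @ \oo --> m n w) ->
  forall n (w : 'I_n -> X), (0 < n)%N ->
     (fun N => N%:R * family_cumulant (z_ N) w : R[i]^o) @ \oo --> m n w.
Proof.
move=> cvg_m n; elim/ltn_ind: n => n IH w n0.
under eq_fun => N do rewrite family_cumulantE // mulrBr.
rewrite -[m n w]subr0; apply: cvgB; first exact: cvg_m.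
rewrite /lower_terms; under eq_fun => N do rewrite mulr_sumr.
apply: cvg_sum0 => pi /andP[piB piT].
have pipart := BNC_partition piB.
have block V : V \in pi -> (0 < #|V| < n)%N.
  by move=> Vpi; exact: BNC_block piB Vpi piT.
have block_cvg V : V \in pi ->
    (fun N => N%:R * family_cumulant (z_ N) (subword w V)) @ \oo
    --> m _ (subword w V).
  by case/block/andP => V0 Vn; exact: IH.
have block_cvg0 V : V \in pi ->
    (fun N => family_cumulant (z_ N) (subword w V)) @ \oo --> (0 : R[i]^o).
  move=> Vpi; rewrite -(mul0r (m _ (subword w V))).
  have prod_cvg := cvgM cvg_inv_natr (block_cvg V Vpi).
  apply: (@cvg_eventually_eq _ _ _ 1%N _ (prod_cvg _)) => N N1 /=.
  by rewrite mulrA mulVf ?mul1r // pnatr_eq0 -lt0n.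
(* V is the block of some position k; W, the block of a position j outside V,
   supplies the factor that tends to 0. *)
have k : 'I_n by case: (n) n0 => // n' _; exact: ord0.
have cover_pi := cover_partition pipart.
have Vpi : pblock pi k \in pi by rewrite pblock_mem // cover_pi.
set V := pblock pi k in Vpi.
have /andP[_ Vn] := block V Vpi.
have [j jV] : exists j, j \notin V.
  apply/existsP; rewrite -negb_forall; apply: contraL Vn => /forallP allV.
  suff -> : V = [set: 'I_n]%SET by rewrite cardsT card_ord ltnn.
  by apply/setP => j; rewrite allV in_setT.
have Wpi : pblock pi j \in pi by rewrite pblock_mem // cover_pi.
have jW : j \in pblock pi j by rewrite mem_pblock cover_pi.
set W := pblock pi j in Wpi jW.
have WV : W != V by apply: contraNneq jV => <-.
under eq_fun => N do rewrite (bigD1 V) //= mulrA.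
have -> : 0 = m _ (subword w V) * \prod_(U in pi | U != V) (0 : R[i]^o).
  by rewrite (bigD1 W) ?Wpi //= mul0r mulr0.
apply: cvgM; first exact: block_cvg.
by apply: cvg_bigop_mul => U /andP[Upi _]; exact: block_cvg0.
Qed.

End Limits.

(** * A family with prescribed cumulants *)

Section FreeFamily.
Context (R : realType) (I J : choiceType).
Local Notation X := (I + J)%type.
Implicit Types (c : forall n, ('I_n -> X) -> R[i]).

(** Noncommutative polynomials over the index set; c only selects the
    expectation that the algebra carries. *)
Definition free_algebra c : Type := malg (fmonom X) R[i].

HB.instance Definition _ c := GRing.Lalgebra.on (free_algebra c).

Lemma free_algebra_scalerAr c (k : R[i]) (P Q : free_algebra c) :
  k *: (P * Q) = P * (k *: Q).
Proof.
apply/malgP => v; rewrite mcoeffZ mcoeffMl.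
rewrite (mcoeffMlw v (fsubset_refl _) (msuppZ_le k Q)) mulr_sumr.
apply: eq_bigr => u _; rewrite mulr_sumr; apply: eq_bigr => t _.
by rewrite mcoeffZ mulrnAr mulrCA.
Qed.

HB.instance Definition _ c :=
  GRing.Lalgebra_isAlgebra.Build R[i] (free_algebra c)
    (@free_algebra_scalerAr c).

(** The empty word is treated apart because a unital functional must send it to
    1. *)
Definition word_moment c (v : seq X) : R[i] :=
  if v is [::] then 1 else moment_of_cumulants c (tnth (in_tuple v)).

Lemma word_momentE c (v : seq X) : (0 < size v)%N ->
  word_moment c v = moment_of_cumulants c (tnth (in_tuple v)).
Proof. by case: v. Qed.

Definition free_expectation c (P : free_algebra c) : R[i] :=
  \sum_(v <- msupp P) mcoeff v P * word_moment c v.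

Lemma free_expectation_linear c : scalar (@free_expectation c).
Proof.
have expE : @free_expectation c =
  mmap idfun (fun v : fmonom X => word_moment c v) by [].
move=> k P Q; rewrite expE raddfD /=; congr (_ + _).
rewrite (mmapEw (msuppZ_le k P)) mmapE mulr_sumr; apply: eq_bigr => v _.
by rewrite mcoeffZ mulrA.
Qed.

HB.instance Definition _ c :=
  GRing.isLinear.Build R[i] (free_algebra c) R[i] *%R (@free_expectation c)
    (@free_expectation_linear c).

Lemma free_expectation_word c (v : fmonom X) :
  free_expectation (mkmalgU v 1 : free_algebra c) = word_moment c v.
Proof. by rewrite /free_expectation msuppU1 big_seq_fset1 mcoeffU1 eqxx mul1r. Qed.

Lemma free_expectation1 c : free_expectation (1 : free_algebra c) = 1.
Proof. by rewrite free_expectation_word fm1. Qed.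

HB.instance Definition _ c :=
  hasExpectation.Build R (free_algebra c) (@free_expectation1 c).

Definition free_gen c (x : X) : free_algebra c := mkmalgU (fmu x) 1.

Lemma prod_free_gen c (v : seq X) :
  \prod_(x <- v) free_gen c x = mkmalgU (FMonom v) 1.
Proof.
elim: v => [|x v IH]; first by rewrite big_nil -fmoneE.
rewrite big_cons IH [LHS]fgmulUU mulr1; congr mkmalgU.
by apply: val_inj; apply: etrans (fmM _ _) _; rewrite fmU.
Qed.

Lemma free_gen_moment c n (w : 'I_n -> X) : (0 < n)%N ->
  family_moment (free_gen c) w = moment_of_cumulants c w.
Proof.
move=> n0; pose t := [tuple w k | k < n].
have -> : family_moment (free_gen c) w = word_moment c t.
  rewrite -(free_expectation_word c (FMonom t)) -prod_free_gen big_tuple.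
  by under [in RHS]eq_bigr => k _ do rewrite tnth_mktuple.
have st : size t = n := size_tuple t.
rewrite word_momentE ?st //.
apply: (@indexed_word_eq _ _ (@moment_of_cumulants R I J c) _ _ st) => j.
by rewrite -(tnth_mktuple w) !(tnth_nth (w (cast_ord st j))).
Qed.

(** Every c is the cumulant functional of some family: the expectation was
    defined through the moment-cumulant formula, which determines cumulants. *)
Lemma free_gen_cumulant c n (w : 'I_n -> X) : (0 < n)%N ->
  family_cumulant (free_gen c) w = c n w.
Proof. by apply: cumulant_unique => *; exact: free_gen_moment. Qed.

End FreeFamily.

(** * Distributions and moments of words *)

Section Words.
Context (R : realType).

Lemma distributionE (X : choiceType) (A : ncProbType R) (z : X -> A) P :
  distribution z P =
  \sum_(v <- msupp P) mcoeff v P * expectation (\prod_(x <- (v : seq X)) z x).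
Proof.
rewrite /distribution /nceval /mmap linear_sum /=; apply: eq_bigr => v _.
by rewrite -scalerAl mul1r linearZ.
Qed.

Lemma distribution_word (X : choiceType) (A : ncProbType R) (z : X -> A) n
    (w : 'I_n -> X) :
  distribution z (mkmalgU (FMonom (mktuple w)) 1) =
  expectation (\prod_(k < n) z (w k)).
Proof.
rewrite distributionE msuppU1 big_seq_fset1 mcoeffU1 eqxx mul1r big_tuple.
by under eq_bigr => k _ do rewrite tnth_mktuple.
Qed.

End Words.

(** * The limit theorem *)

(** All powers of an idempotent p agree, so p contributes one factor
    [expectation p], whatever the length of the word; the empty word, where p
    would contribute 1, is the exception. *)
Lemma tens_projection_moment (R : realType) (X : Type) (A : ncProbType R)
    (C : cstarProbType R) (a : X -> A) (p : C) n (w : 'I_n -> X) :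
  p * p = p -> (0 < n)%N ->
  expectation (\prod_(k < n) ((a (w k)) ⊗ p : A ⊗ C)) =
  expectation (\prod_(k < n) a (w k)) * expectation p.
Proof.
move=> pp; case: n w => // n w _; rewrite -expectation_tens; congr (expectation _).
elim: n w => [|n IH] w; first by rewrite !big_ord_recl !big_ord0 !mulr1.
rewrite big_ord_recl (IH (fun k => w (lift ord0 k))) tensM pp.
by rewrite [in RHS]big_ord_recl.
Qed.

Lemma cvg_family_moment (R : realType) (I J : Type) (A_ : nat -> ncProbType R)
    (z_ : forall N, I + J -> A_ N) (B : ncProbType R) (z : I + J -> B) :
  (forall n (w : 'I_n -> I + J), (0 < n)%N ->
     ((fun N => family_cumulant (z_ N) w : R[i]^o) @ \oo -->
     (family_cumulant z w : R[i]^o))%classic) ->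
  forall n (w : 'I_n -> I + J),
     ((fun N => family_moment (z_ N) w : R[i]^o) @ \oo -->
     (family_moment z w : R[i]^o))%classic.
Proof.
move=> cvg_k [|n] w.
  rewrite /family_moment big_ord0 expectation1.
  by under eq_fun => N do rewrite big_ord0 expectation1; exact: cvg_cst.
rewrite family_momentE //; under eq_fun => N do rewrite family_momentE //.
exact: cvg_moment_of_cumulants.
Qed.

(** A moment of a polynomial is a finite linear combination of moments of words,
    with coefficients that do not depend on N. *)
Lemma cvg_distribution (R : realType) (X : choiceType) (A_ : nat -> ncProbType R)
    (z_ : forall N, X -> A_ N) (B : ncProbType R) (z : X -> B) :
  (forall n (w : 'I_n -> X),
     ((fun N => expectation (\prod_(k < n) z_ N (w k)) : R[i]^o) @ \oo -->
     (expectation (\prod_(k < n) z (w k)) : R[i]^o))%classic) ->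
  cvg_in_distribution (fun N => distribution (z_ N)) (distribution z).
Proof.
move=> cvg_z P; rewrite distributionE; under eq_fun => N do rewrite distributionE.
apply: cvg_bigop_add => v _; apply: cvgM; first exact: cvg_cst.
rewrite big_tnth; under eq_fun => N do rewrite big_tnth.
exact: cvg_z.
Qed.

Theorem theorem2p3 (R : realType) (I J : choiceType) (A : ncProbType R)
    (a : I + J -> A) (lambda : R) (lambda_gt0 : 0 < lambda)
    (C : nat -> cstarProbType R) (p : forall N : nat, C N)
    (p_projection : forall N : nat, lambda < N%:R -> is_projection (p N))
    (p_expectation : forall N : nat, lambda < N%:R ->
       expectation (p N) = (lambda / N%:R)%:C)
    (a_ : forall N : nat, 'I_N -> I + J -> A ⊗ C N)
    (a_bifree : forall N : nat, lambda < N%:R -> bifree (a_ N))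
    (a_distribution : forall N : nat, lambda < N%:R -> forall m : 'I_N,
       distribution (a_ N m) = distribution (fun k => a k ⊗ p N)) :
  (exists mu, compound_bifree_poisson_distribution lambda a mu) /\
  (forall mu, compound_bifree_poisson_distribution lambda a mu ->
     cvg_in_distribution
       (fun N => distribution (fun k : I + J => \sum_(m < N) a_ N m k)) mu).
Proof.
pose c n (w : 'I_n -> I + J) : R[i] := lambda%:C * family_moment a w.
split.
  exists (distribution (free_gen c)), (free_algebra c), (free_gen c).
  by split=> // n w n0; exact: free_gen_cumulant.
move=> _ [B [z [zP ->]]].
pose S N (x : I + J) : A ⊗ C N := \sum_(m < N) a_ N m x.
apply: (@cvg_distribution _ _ _ S); apply: (@cvg_family_moment _ _ _ _ S _ z).
move=> n w n0.
have -> : family_cumulant z w = c n w by exact: zP.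
pose N0 := (Num.truncn lambda).+1.
have lambda_lt N : (N0 <= N)%N -> lambda < N%:R.
  move=> N0N; apply: lt_le_trans (truncnS_gt _) _.
  by rewrite ler_nat.
pose b N (x : I + J) : A ⊗ C N := a x ⊗ p N.
have b_cumulant :
    ((fun N => N%:R * family_cumulant (b N) w : R[i]^o) @ \oo -->
    (c n w : R[i]^o))%classic.
  apply: (@cvg_natr_mul_cumulant _ _ _ _ _ c) n0 => {}n {}w n0.
  apply: (@cvg_eventually_eq _ (fun=> c n w) _ _ N0); last exact: cvg_cst.
  move=> N /lambda_lt ltN; have [_ pp] := p_projection N ltN.
  rewrite /family_moment tens_projection_moment // p_expectation //.
  rewrite /c mulrCA mulrC; congr (_ * _).
  rewrite -(rmorph_nat (real_complex R)) -rmorphM mulrC divfK //.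
  by rewrite gt_eqF // (lt_trans lambda_gt0).
apply: (cvg_eventually_eq (N0 := N0) _ b_cumulant) => N /lambda_lt ltN.
rewrite family_cumulant_sum //; last exact: a_bifree.
have eq_cumulant m : family_cumulant (a_ N m) w = family_cumulant (b N) w.
  apply: eq_family_cumulant n0 => r u.
  by rewrite /family_moment -!distribution_word a_distribution.
by under eq_bigr do rewrite eq_cumulant; rewrite sumr_const card_ord mulr_natl.
Qed.
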